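(* Consider the double input-single output Mix with delay constraint $T=1$ and arrival rates $\lambda_R,\lambda_B\in(0,1)$, as described in the context. There exist probabilities $p^*,d^*,r^*\in[0,1]$, depending only on $\lambda_R$ and $\lambda_B$, such that the following mixing strategy $\psi^*$ is optimal, i.e. it maximizes the anonymity $A^\psi$ over all $\psi\in\Psi_1$. At each time $k$, given $Q_{k-1}$ and $I_k$: 1. If $Q_{k-1}=\emptyset$: - if $I_k\in\{\emptyset,R,B\}$: set $Q_k=I_k$ and $O_k=\emptyset$ (queue the arrival, transmit nothing); - if $I_k=RB$: transmit only $R$ with probability $p^*$, or only $B$ with probability $1-p^*$, and set $Q_k=I_k\setminus O_k$. 2. If $Q_{k-1}=R$: - if $I_k\in\{\emptyset,R\}$: set $O_k=Q_{k-1}$ and $Q_k=I_k$; - if $I_k=B$: transmit a uniformly random permutation of $R$ and $B$, and set $Q_k=\emptyset$; - if $I_k=RB$: with probability $d^*$ transmit $RR$ (so $Q_k=B$), and with probability $1-d^*$ transmit a uniformly random permutation of $R$ and $B$ (so $Q_k=R$). 3. If $Q_{k-1}=B$: - if $I_k\in\{\emptyset,B\}$: set $O_k=Q_{k-1}$ and $Q_k=I_k$; - if $I_k=R$: transmit a uniformly random permutation of $R$ and $B$, and set $Q_k=\emptyset$; - if $I_k=RB$: with probability $r^*$ transmit $BB$ (so $Q_k=R$), and with probability $1-r^*$ transmit a uniformly random permutation of $R$ and $B$ (so $Q_k=B$). (Starting from $Q_0=\emptyset$, the state $Q_{k-1}=RB$ never occurs under this strategy.)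
   Context: **Model.** Time is slotted, $k=1,2,\dots$. A Mix has two input links, each of capacity 1 packet/slot (one carrying red packets, one carrying blue packets), and one output link of capacity 2 packets/slot. In each slot a red packet arrives with probability $\lambda_R$ and a blue packet arrives with probability $\lambda_B$, independently of each other and across slots. $I_k\in\{\emptyset,R,B,RB\}$ denotes the arrivals in slot $k$ (none, red only, blue only, both). Within each slot, arrivals occur first and then departures. No packet is dropped. The output in slot $k$ is the ordered color sequence $O_k\in\{\emptyset,R,B,RR,BB,RB,BR\}$ of the packets transmitted in slot $k$ (the order matters). **Delay constraint $T=1$.** Every packet must be transmitted in the slot in which it arrives or in the next slot. $Q_k\in\{\emptyset,R,B,RB\}$ denotes the packets that arrived in slot $k$ and are still in the Mix at the end of slot $k$; all of them must be transmitted in slot $k+1$. Initially $Q_0=\emptyset$. Packets of the same color are transmitted in order of arrival. **Strategies.** A mixing strategy decides, at each slot $k$, which packets from $Q_{k-1}$ and $I_k$ to transmit and in which order. It may be randomized, and it is causal: the decision in slot $k$ is based on $I^{(k)}$, $O^{(k-1)}$ and independent randomization, and future arrivals are independent of the past. $\Psi_1$ is the set of all such strategies satisfying the delay constraint $T=1$. **Anonymity.** For a process $X$ write $X^{(N)}=(X_1,\dots,X_N)$. Let $G_k=|O_k|\in\{0,1,2\}$ be the number of packets transmitted in slot $k$; the eavesdropper observes it together with the arrivals. With $H(\cdot|\cdot)$ Shannon conditional entropy in bits, the anonymity (bits/packet) of $\psi$ is $$A^\psi=\lim_{N\to\infty}\frac{1}{N(\lambda_R+\lambda_B)}H\big(O^{(N)}\mid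 I^{(N)},G^{(N)}\big),$$ where the eavesdropper's detection is assumed causal and online (detection of $O_k$ is made at time $k$ and uses only the history up to time $k$), so that the entropy is evaluated as $$H\big(O^{(N)}\mid I^{(N)},G^{(N)}\big)=\sum_{k=1}^N H\big(O_k\mid I^{(k)},G^{(k)},O^{(k-1)}\big),$$ i.e. the right-hand side of this identity is the quantity used in the definition of $A^\psi$. Maximization is over strategies for which the limit exists. *)

(* Defs.v *)
From HB Require Import structures.
From mathcomp Require Import all_boot all_order all_algebra.
From mathcomp Require Import reals topology normedtype sequences exp.

Set Implicit Arguments.
Unset Strict Implicit.
Unset Printing Implicit Defensive.

Import Order.TTheory GRing.Theory Num.Theory numFieldNormedType.Exports.

Local Open Scope ring_scope.

Variant color := Red | Blue.

Definition bool_of_color c := if c is Red then true else false.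
Definition color_of_bool b := if b then Red else Blue.
Lemma bool_of_colorK : cancel bool_of_color color_of_bool.
Proof. by case. Qed.

HB.instance Definition _ := Finite.copy color (can_type bool_of_colorK).

(* At most one packet of each colour arrives per slot, and none survives longer
   than the next slot, so both I_k and Q_k are sets of colours. *)
Notation arrivals := {set color}.
Notation queue := {set color}.

(* O_k: the ordered colour sequences of length at most 2. *)
Notation output := (2.-bseq color).

(* The pair (I_k, O_k); a history is the chronological list of slots 1, 2, ... *)
Notation slot := ({set color} * 2.-bseq color)%type.

(* With backlog [q] (one slot old) and new arrivals [i], the output [o] must
   contain every packet of [q] and may contain packets of [i].  Packets of the
   same colour leave in order of arrival, so the colours in [o] determine which
   packets are sent. *)
Definition feasible (q : queue) (i : arrivals) (o : output) : Prop :=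
  forall c : color,
    ((c \in q) <= count_mem c o <= (c \in q) + (c \in i))%N.

(* By the first-in first-out rule the new packet of colour [c] is still in the
   Mix iff no more packets of colour [c] were sent than were queued. *)
Definition next_queue (q : queue) (x : slot) : queue :=
  [set c in x.1 | (count_mem c x.2 <= (c \in q))%N].

(* Q_k after the history of the first k slots; Q_0 is empty. *)
Definition backlog (h : seq slot) : queue := foldl next_queue set0 h.

Section Mix.
Variable R : realType.

(* [psi h i o] is the conditional probability that O_k = o, given the history
   [h] = (I_1, O_1), ..., (I_(k-1), O_(k-1)) and I_k = i; the slot number is
   k = (size h).+1. *)
Definition strategy := seq slot -> arrivals -> output -> R.

Definition randomized (psi : strategy) : Prop :=
  forall h i, (forall o, 0 <= psi h i o) /\ \sum_o psi h i o = 1.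

Definition arrival_prob (lamR lamB : R) (i : arrivals) : R :=
  (if Red \in i then lamR else 1 - lamR) *
  (if Blue \in i then lamB else 1 - lamB).

(* Joint law of (I_1, O_1), ..., (I_n, O_n). *)
Definition law (lamR lamB : R) (psi : strategy) (n : nat) (w : n.-tuple slot)
    : R :=
  \prod_(k < n) (arrival_prob lamR lamB (tnth w k).1 *
                 psi (take k w) (tnth w k).1 (tnth w k).2).

Definition respects_delay (lamR lamB : R) (psi : strategy) : Prop :=
  forall n (w : n.-tuple slot), 0 < law lamR lamB psi w ->
  forall k : 'I_n, feasible (backlog (take k w)) (tnth w k).1 (tnth w k).2.

(* The class Psi_1. *)
Definition Psi1 (lamR lamB : R) (psi : strategy) : Prop :=
  randomized psi /\ respects_delay lamR lamB psi.

Definition log2 (x : R) : R := ln x / ln 2.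

Definition Prob (W : finType) (P : W -> R) (E : pred W) : R :=
  \sum_(w | E w) P w.

(* H(X | Y) = E[- log2 p(X | Y)], in bits, under the probability mass function
   [P]; outcomes of probability 0 contribute 0. *)
Definition cond_entropy (W : finType) (A B : eqType) (P : W -> R)
    (X : W -> A) (Y : W -> B) : R :=
  - \sum_w P w * log2 (Prob P [pred v | (X v == X w) && (Y v == Y w)] /
                       Prob P [pred v | Y v == Y w]).

(* H(O_k | I^(k), G^(k), O^(k-1)) for the slot number k = m.+1. *)
Definition slot_entropy (lamR lamB : R) (psi : strategy) (m : nat) : R :=
  cond_entropy (@law lamR lamB psi m.+1)
    (fun w : m.+1.-tuple slot => (tnth w ord_max).2)
    (fun w : m.+1.-tuple slot =>
       ([seq x.1 | x : slot <- w],
        [seq size x.2 | x : slot <- w],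
        [seq x.2 | x : slot <- take m w])).

Definition anonymity_seq (lamR lamB : R) (psi : strategy) (N : nat) : R :=
  (N%:R * (lamR + lamB))^-1 * \sum_(m < N) slot_entropy lamR lamB psi m.

(* A^psi, meaningful when [anonymity_seq lamR lamB psi] converges. *)
Definition anonymity (lamR lamB : R) (psi : strategy) : R :=
  limn (anonymity_seq lamR lamB psi).

Definition optimal (lamR lamB : R) (psi : strategy) : Prop :=
  [/\ Psi1 lamR lamB psi,
      cvgn (anonymity_seq lamR lamB psi) &
      forall phi : strategy, Psi1 lamR lamB phi ->
        cvgn (anonymity_seq lamR lamB phi) ->
        anonymity lamR lamB phi <= anonymity lamR lamB psi].

Definition send (s : seq color) : output -> R :=
  fun o => ((o : seq color) == s)%:R.

(* With probability [t] follow [f], otherwise follow [g]. *)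
Definition mix (t : R) (f g : output -> R) : output -> R :=
  fun o => t * f o + (1 - t) * g o.

Definition send_shuffled : output -> R :=
  mix 2^-1 (send [:: Red; Blue]) (send [:: Blue; Red]).

(* The last line (backlog RB) is a dummy value for a state that is never
   reached. *)
Definition star_rule (p d r : R) (q : queue) (i : arrivals) : output -> R :=
  if q == set0 then
    if i == [set Red; Blue] then mix p (send [:: Red]) (send [:: Blue])
    else send [::]
  else if q == [set Red] then
    if i == [set Blue] then send_shuffled
    else if i == [set Red; Blue] then mix d (send [:: Red; Red]) send_shuffled
    else send [:: Red]
  else if q == [set Blue] then
    if i == [set Red] then send_shuffled
    else if i == [set Red; Blue] then mix r (send [:: Blue; Blue]) send_shuffled
    else send [:: Blue]
  else send_shuffled.

Definition psi_star (p d r : R) : strategy :=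
  fun h i => star_rule p d r (backlog h) i.

End Mix.

(* Main.v *)
(* Given the history, only the backlog matters: slot k contributes the entropy
   of O_k given |O_k| and moves the backlog to Q_k, so the anonymity is the
   average reward of a Markov decision process with the four backlogs as states.
   Writing the relative values of the states as ln 1, ln X, ln Y and ln 2 (for
   empty, R, B and RB), Gibbs' inequality inside each output size bounds reward
   plus next value by the logarithm of the largest sum, over the outputs of one
   size, of the next values; psi* attains this bound when p*, d*, r* are the
   Gibbs weights.  The Bellman equations then reduce to two equations in (X, Y),
   and the expected values telescope along the slots. *)
Require Import Defs.
From HB Require Import structures.
From mathcomp Require Import all_boot all_order all_algebra.
From mathcomp Require Import reals topology normedtype sequences exp.
From mathcomp Require Import classical_sets ring lra.

Set Implicit Arguments.
Unset Strict Implicit.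
Unset Printing Implicit Defensive.

Import Order.TTheory GRing.Theory Num.Theory numFieldNormedType.Exports.

Local Open Scope ring_scope.

(** * Solution of the two Bellman equations *)

Lemma ln2_gt0 (R : realType) : 0 < ln 2 :> R.
Proof. by rewrite ln_gt0 // ltr1n. Qed.

(** In the Bellman equations the ratio (Y + 2X) / (X + Y) depends only on X / Y; this is its
    logarithm as a function of t = ln X - ln Y. The ratio (X + 2Y) / (X + Y) corresponds to -t. *)
Definition log_gain (R : realType) (t : R) : R :=
  ln (1 + 2 * expR t) - ln (1 + expR t).

Lemma log_gain_bounds (R : realType) (t : R) : 0 <= log_gain t <= ln 2.
Proof.
have e0 := expR_gt0 t.
rewrite /log_gain subr_ge0 lerBlDr -lnM ?posrE; try lra.
by rewrite !ler_ln ?posrE; lra.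
Qed.

Lemma log_gain_continuous (R : realType) : continuous (@log_gain R).
Proof.
have ln1D (h : R -> R) : continuous h -> (forall t, 0 <= h t) ->
    continuous (fun t => ln (1 + h t)).
  move=> ch h0 t; apply: (@continuous_comp _ _ _ (fun t => 1 + h t) (@ln R)).
    by apply: cvgD; [exact: cvg_cst|exact: ch].
  by apply: continuous_ln; rewrite ltr_wpDr.
move=> t; apply: cvgB; last first.
  by apply: (ln1D expR) => s; [exact: continuous_expR|exact: expR_ge0].
apply: (ln1D (fun t => 2 * expR t)) => s; last by rewrite mulr_ge0 ?expR_ge0.
by apply: cvgMl_tmp; exact: continuous_expR.
Qed.

Lemma log_gain_lnB (R : realType) (x y : R) :
  log_gain (x - y) = ln (expR y + 2 * expR x) - ln (expR x + expR y).
Proof.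
have ex := expR_gt0 x; have ey := expR_gt0 y.
have -> : expR y + 2 * expR x = expR y * (1 + 2 * expR (x - y)).
  by rewrite expRD expRN; field; rewrite gt_eqF.
have -> : expR x + expR y = expR y * (1 + expR (x - y)).
  by rewrite expRD expRN; field; rewrite gt_eqF.
have e0 := expR_gt0 (x - y).
by rewrite /log_gain !lnM ?posrE; try lra.
Qed.

(* For a fixed difference [t = ln X - ln Y] the two equations are linear in
   [(ln X, ln Y)]; the intermediate value theorem then matches the difference of
   their solution with [t]. *)
Lemma bellman_solution (R : realType) (a b : R) :
  0 < a < 1 -> 0 < b < 1 ->
  exists X Y : R,
    [/\ 1 <= X <= 2, 1 <= Y <= 2,
        ln X + b * (1 - a) * ln Y + a * b * ln (X + Y) =
          b * (1 - a) * ln 2 + a * b * ln (Y + 2 * X) &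
        ln Y + a * (1 - b) * ln X + a * b * ln (X + Y) =
          a * (1 - b) * ln 2 + a * b * ln (X + 2 * Y)].
Proof.
move=> ha hb; have c0 := ln2_gt0 R; set c := ln 2 in c0 *.
pose al := a * (1 - b); pose be := b * (1 - a); pose D := 1 - al * be.
have [al0 be0 ab0] : [/\ 0 < al, 0 < be & 0 < a * b].
  by split; apply: mulr_gt0; lra.
have alE : al + a * b = a by rewrite /al; ring.
have beE : be + a * b = b by rewrite /be; ring.
have D0 : 0 < D by rewrite /D; nra.
pose f t := be * c + a * b * log_gain t.
pose g t := al * c + a * b * log_gain (- t).
(* Cramer's rule for x + be y = f t, y + al x = g t, with determinant [D]. *)
pose x t := (f t - be * g t) / D; pose y t := (g t - al * f t) / D.
have f01 t : 0 <= f t <= c.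
  by have := log_gain_bounds t; rewrite -/c /f => h; nra.
have g01 t : 0 <= g t <= c.
  by have := log_gain_bounds (- t); rewrite -/c /g => h; nra.
have f_ge t : be * c <= f t <= be * c + a * b * c.
  by have := log_gain_bounds t; rewrite -/c /f => h; nra.
have g_ge t : al * c <= g t <= al * c + a * b * c.
  by have := log_gain_bounds (- t); rewrite -/c /g => h; nra.
(* The lower bound uses f >= be c and g <= c, the upper one f <= c and g >= al c; [y] is
   symmetric. *)
have x0c t : 0 <= x t <= c.
  have := f_ge t; have := g_ge t; have := f01 t; have := g01 t => h1 h2 h3 h4.
  rewrite /x ler_pdivrMr // ler_pdivlMr // mul0r /D.
  by apply/andP; split; nra.
have y0c t : 0 <= y t <= c.
  have := f_ge t; have := g_ge t; have := f01 t; have := g01 t => h1 h2 h3 h4.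
  rewrite /y ler_pdivrMr // ler_pdivlMr // mul0r /D.
  by apply/andP; split; nra.
have cf : continuous f.
  by move=> t; apply: cvgD; [exact: cvg_cst|apply: cvgMl_tmp; exact: log_gain_continuous].
have cg : continuous g.
  move=> t; apply: cvgD; [exact: cvg_cst|apply: cvgMl_tmp].
  apply: (@continuous_comp _ _ _ (fun t : R => - t) (@log_gain R)).
    exact: opp_continuous.
  exact: log_gain_continuous.
have ch : continuous (fun t => x t - y t - t).
  move=> t; apply: cvgB; last exact: cvg_id.
  apply: cvgB; apply: cvgMr_tmp.
    by apply: cvgB; [exact: cf|apply: cvgMl_tmp; exact: cg].
  by apply: cvgB; [exact: cg|apply: cvgMl_tmp; exact: cf].
(* Since x and y stay in [0, c], x - y - t is nonnegative at -c and nonpositive at c. *)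
have [|||u _ hu] := @IVT R (fun t => x t - y t - t) (- c) c 0.
- lra.
- exact: continuous_subspaceT.
- have := x0c c; have := y0c c; have := x0c (- c); have := y0c (- c).
  by move=> *; rewrite ge_min le_max; apply/andP; split; apply/orP; [right|left]; lra.
have uE : u = x u - y u by lra.
exists (expR (x u)), (expR (y u)).
have expc : expR c = 2 by rewrite lnK // posrE.
split.
- by rewrite -expc -expR0 !ler_expR.
- by rewrite -expc -expR0 !ler_expR.
- have := log_gain_lnB (x u) (y u); rewrite -uE !expRK => h.
  suff : x u + be * y u = f u by rewrite /f h /be => hh; lra.
  by rewrite /x /y /D; field; rewrite -/D gt_eqF.
- have := log_gain_lnB (y u) (x u).
  rewrite -(opprB (x u)) -uE !expRK (addrC (expR (y u)) (expR (x u))) => h.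
  suff : y u + al * x u = g u by rewrite /g h /al => hh; lra.
  by rewrite /x /y /D; field; rewrite -/D gt_eqF.
Qed.

(** * Finite sums over colour sets and outputs; Gibbs' inequality *)

Lemma eq_colors (A B : {set color}) :
  (A == B) = ((Red \in A) == (Red \in B)) && ((Blue \in A) == (Blue \in B)).
Proof.
apply/eqP/andP => [->|[/eqP eR /eqP eB]]; first by rewrite !eqxx.
by apply/setP; case.
Qed.

Definition colors (r b : bool) : {set color} := [set c | if c is Red then r else b].

Lemma sum_colors (V : nmodType) (F : {set color} -> V) :
  \sum_i F i = F (colors true true) + F (colors true false)
             + F (colors false true) + F (colors false false).
Proof.
have bij : bijective (fun x : bool * bool => colors x.1 x.2).
  exists (fun A : {set color} => (Red \in A, Blue \in A)) => [[r b]|A] /=.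
    by rewrite !inE.
  by apply/setP; case; rewrite inE.
rewrite (reindex _ (onW_bij _ bij)) -(pair_bigA _ (fun r b => F (colors r b))) /=.
by rewrite !big_bool /= addrA.
Qed.

Definition outputs : seq (2.-bseq color) :=
  [:: [bseq of [::]]; [bseq Red]; [bseq Blue]; [bseq Red; Red]; [bseq Red; Blue];
      [bseq Blue; Red]; [bseq Blue; Blue]].

Lemma sum_outputs (V : nmodType) (P : pred (2.-bseq color)) (F : 2.-bseq color -> V) :
  \sum_(o | P o) F o = \sum_(o <- outputs | P o) F o.
Proof.
apply: perm_big; apply: uniq_perm; rewrite ?index_enum_uniq // => o.
rewrite mem_index_enum; apply/esym.
by case: o => [[|[] [|[] [|? ?]]] ho] //; rewrite !inE -!val_eqE.
Qed.

(** Apply ln z <= z - 1 to z = w m / (mu K), where m is the mass of the group of o, and average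
    under mu. Exchanging the two sums turns the total of w m / K into a mu-average of group sums of
    w divided by K, which is at most 1. *)
Lemma gibbs_grouped (R : realType) (T : finType) (S : eqType) (f : T -> S) (mu w : T -> R) (K : R) :
  (forall o, 0 <= mu o) -> \sum_o mu o = 1 ->
  (forall o, 0 <= w o) -> (forall o, 0 < mu o -> 0 < w o) ->
  0 < K -> (forall s, \sum_(o | f o == s) w o <= K) ->
  \sum_o mu o * (ln (w o) - ln (mu o / \sum_(o' | f o' == f o) mu o')) <= ln K.
Proof.
move=> mu0 mu1 w0 wpos K0 hK.
pose m o := \sum_(o' | f o' == f o) mu o'.
have term o : mu o * (ln (w o) - ln (mu o / m o)) <=
    w o * m o / K - mu o + mu o * ln K.
  have m_ge : mu o <= m o by rewrite /m (bigD1 o) //= lerDl sumr_ge0.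
  have m0 : 0 <= m o by exact: le_trans m_ge.
  (* An outcome of mass 0 contributes 0 on the left and a nonnegative term on the right. *)
  have := mu0 o; rewrite le_eqVlt => /orP[/eqP <-|mup].
    by rewrite !mul0r subr0 addr0 !mulr_ge0 // invr_ge0 ltW.
  have wp := wpos _ mup; have mp : 0 < m o by apply: lt_le_trans m_ge.
  pose z := w o * m o / (mu o * K).
  have zp : 0 < z by rewrite !divr_gt0 // mulr_gt0.
  have lnz : ln (w o) - ln (mu o / m o) - ln K = ln z.
    rewrite -!ln_div ?posrE ?divr_gt0 //; congr ln.
    by rewrite /z; field; rewrite !gt_eqF.
  have : ln z <= z - 1.
    by have := @le_ln1Dx _ (z - 1); rewrite addrCA subrr addr0 => ->//; lra.
  rewrite -lnz -(ler_pM2l mup) => h.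
  have -> : w o * m o / K = mu o * z by rewrite /z; field; rewrite !gt_eqF.
  by lra.
apply: le_trans (ler_sum _ (fun o _ => term o)) _.
rewrite big_split /= sumrB -!mulr_suml !mu1 mul1r gerDr subr_le0.
rewrite ler_pdivrMr // mul1r -[leRHS]mul1r -{1}mu1 mulr_suml.
under eq_bigr => o _ do rewrite /m mulr_sumr.
rewrite (exchange_big_dep predT) //=; apply: ler_sum => o _.
rewrite -mulr_suml mulrC ler_wpM2l //.
by under eq_bigl do rewrite eq_sym.
Qed.

(** * Law of the histories and entropy of one slot *)

Lemma sum_rcons_tuple (V : nmodType) (T : finType) (n : nat) (P : pred (n.+1.-tuple T))
    (F : n.+1.-tuple T -> V) :
  \sum_(w | P w) F w =
  \sum_(h : n.-tuple T) \sum_(x | P [tuple of rcons h x]) F [tuple of rcons h x].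
Proof.
have bij : bijective (fun hx : n.-tuple T * T => [tuple of rcons hx.1 hx.2]).
  apply: inj_card_bij => [[h x] [h' x'] /(congr1 val) /= /rcons_inj []|].
    by move=> /val_inj -> ->.
  by rewrite card_prod !card_tuple expnS mulnC.
rewrite (reindex _ (onW_bij _ bij)) /= pair_big_dep.
by apply: eq_big => [[h x]|[h x]].
Qed.

Lemma backlog_rcons h x : backlog (rcons h x) = next_queue (backlog h) x.
Proof. by rewrite /backlog -cats1 foldl_cat. Qed.

Section Law.
Variables (R : realType) (lamR lamB : R).
Hypotheses (hR : 0 < lamR < 1) (hB : 0 < lamB < 1).

Lemma arrival_prob_gt0 i : 0 < arrival_prob lamR lamB i.
Proof. by rewrite /arrival_prob; apply: mulr_gt0; case: ifP => _; move: hR hB; lra. Qed.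

Lemma sum_arrival_prob : \sum_i arrival_prob lamR lamB i = 1.
Proof. by rewrite sum_colors /arrival_prob !inE; ring. Qed.

Variable psi : strategy R.
Hypothesis rpsi : randomized psi.

Lemma law_rcons n (h : n.-tuple slot) (x : slot) :
  law lamR lamB psi [tuple of rcons h x] =
  law lamR lamB psi h * (arrival_prob lamR lamB x.1 * psi h x.1 x.2).
Proof.
have sz := size_tuple h.
rewrite /law big_ord_recr /=; congr (_ * _); last first.
  by rewrite !(tnth_nth x) /= nth_rcons sz ltnn eqxx -cats1 take_size_cat.
apply: eq_bigr => k _.
have -> : tnth [tuple of rcons h x] (widen_ord (leqnSn n) k) = tnth h k.
  by rewrite !(tnth_nth x) /= nth_rcons sz ltn_ord.
by rewrite /= -cats1 takel_cat // sz ltnW.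
Qed.

Lemma law_ge0 n (w : n.-tuple slot) : 0 <= law lamR lamB psi w.
Proof.
apply: prodr_ge0 => k _; rewrite mulr_ge0 //; first exact/ltW/arrival_prob_gt0.
by case: (rpsi (take k w) (tnth w k).1).
Qed.

Lemma law_rcons_gt0 n (h : n.-tuple slot) (x : slot) :
  (0 < law lamR lamB psi [tuple of rcons h x]) =
  (0 < law lamR lamB psi h) && (0 < psi h x.1 x.2).
Proof.
rewrite law_rcons mulrCA pmulr_rgt0 ?arrival_prob_gt0 // !lt0r mulf_eq0 negb_or.
by rewrite mulr_ge0 ?law_ge0 ?(rpsi h x.1).1 // !andbT.
Qed.

Lemma sum_law_rcons n (F : n.+1.-tuple slot -> R) :
  \sum_w law lamR lamB psi w * F w =
  \sum_(h : n.-tuple slot) law lamR lamB psi h *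
    \sum_i arrival_prob lamR lamB i *
      \sum_o psi h i o * F [tuple of rcons h (i, o)].
Proof.
rewrite sum_rcons_tuple; apply: eq_bigr => h _.
under [in RHS]eq_bigr do rewrite mulr_sumr.
rewrite pair_bigA mulr_sumr; apply: eq_bigr => -[i o] _ /=.
by rewrite law_rcons /=; ring.
Qed.

Lemma sum_law n : \sum_(w : n.-tuple slot) law lamR lamB psi w = 1.
Proof.
elim: n => [|n IHn].
  rewrite (eq_bigr (fun _ => 1)) => [|w _]; last by rewrite /law big_ord0.
  by rewrite big_const card_tuple iter_addr addr0.
under eq_bigr do rewrite -[law _ _ _ _]mulr1.
rewrite sum_law_rcons -[RHS]IHn; apply: eq_bigr => h _.
under eq_bigr => i _.
  under eq_bigr do rewrite mulr1.
  by rewrite (rpsi h i).2 mulr1; over.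
by rewrite sum_arrival_prob mulr1.
Qed.

(** The conditioning variable determines the past history, the current arrivals and the current
    output size, and nothing more. The weight of the history and arrivals then cancels in the
    conditional probability. The factor ln 2 converts bits to nats. *)
Lemma slot_entropyE m :
  slot_entropy lamR lamB psi m * ln 2 =
  \sum_(h : m.-tuple slot) law lamR lamB psi h *
    \sum_i arrival_prob lamR lamB i *
      \sum_o psi h i o *
        - ln (psi h i o / \sum_(o' : 2.-bseq color | size o' == size o) psi h i o').
Proof.
rewrite /slot_entropy; set X := (X in cond_entropy _ X _); set Y := (X in cond_entropy _ _ X).
rewrite /cond_entropy; set P := @law _ _ _ _ _.
rewrite mulNr mulr_suml -sumrN.
pose F (w : m.+1.-tuple slot) :=
  - ln (Prob P [pred v | (X v == X w) && (Y v == Y w)] /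
        Prob P [pred v | Y v == Y w]).
rewrite (eq_bigr (fun w => P w * F w)) => [|w _]; last first.
  by rewrite /F /log2 mulrA mulfVK ?mulrN // gt_eqF // ln_gt0 // ltr1n.
rewrite sum_law_rcons; apply: eq_bigr => h _.
(* Null histories and null outputs are set aside, so that the cancelled weight is nonzero. *)
have := @law_ge0 m h; rewrite le_eqVlt => /orP[/eqP <-|lawh]; first by rewrite !mul0r.
congr (_ * _); apply: eq_bigr => i _; congr (_ * _); apply: eq_bigr => o _.
have := (rpsi h i).1 o; rewrite le_eqVlt => /orP[/eqP <-|psio]; first by rewrite !mul0r.
have Xr (h' : m.-tuple slot) x : X [tuple of rcons h' x] = x.2.
  by rewrite /X (tnth_nth x) /= nth_rcons size_tuple ltnn eqxx.
have Yr (h' : m.-tuple slot) x : (Y [tuple of rcons h' x] == Y [tuple of rcons h (i, o)])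
    = (h' == h) && ((x.1 == i) && (size x.2 == size o)).
  rewrite /Y /= -!cats1 !take_size_cat ?size_tuple // !cats1 !map_rcons.
  rewrite !xpair_eqE !eqseq_rcons.
  apply/idP/idP; last by case/andP=> /eqP -> /andP[-> ->]; rewrite !eqxx.
  case/andP => /andP[/andP[/eqP e1 ->] /andP[_ ->]] /eqP e2; rewrite !andbT.
  (* A history is recovered from its list of arrivals and its list of outputs. *)
  by apply/eqP/val_inj; rewrite /= -[LHS]zip_unzip -[RHS]zip_unzip /unzip1 /unzip2 e1 e2.
have PY : Prob P [pred v | Y v == Y [tuple of rcons h (i, o)]] =
    law lamR lamB psi h * arrival_prob lamR lamB i
      * \sum_(o' : 2.-bseq color | size o' == size o) psi h i o'.
  rewrite /Prob sum_rcons_tuple (bigD1 h) //= [X in _ + X]big1 ?addr0 => [|h' h'h]; last first.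
    by apply: big_pred0 => x; rewrite /= Yr (negPf h'h).
  under eq_bigl do rewrite Yr eqxx /=.
  have -> : \sum_(o' : 2.-bseq color | size o' == size o) psi h i o' =
      \sum_(i' | i' == i) \sum_(o' : 2.-bseq color | size o' == size o) psi h i' o'.
    by rewrite big_pred1_eq.
  rewrite pair_big mulr_sumr; apply: eq_bigr => -[i' o'] /= /andP[/eqP -> _].
  by rewrite /P law_rcons mulrA.
have PXY : Prob P [pred v | (X v == X [tuple of rcons h (i, o)]) &&
      (Y v == Y [tuple of rcons h (i, o)])] =
    law lamR lamB psi h * arrival_prob lamR lamB i * psi h i o.
  rewrite /Prob sum_rcons_tuple (bigD1 h) //= [X in _ + X]big1 ?addr0 => [|h' h'h]; last first.
    by apply: big_pred0 => x; rewrite /= Yr (negPf h'h) andbF.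
  rewrite (big_pred1 (i, o)) /P ?law_rcons ?mulrA // => -[i' o'].
  rewrite /= Yr !Xr eqxx xpair_eqE /= andbC -andbA.
  by case: eqP => //= _; case: (eqVneq o' o) => [->|]; rewrite ?eqxx ?andbF.
rewrite /F PXY PY; congr (_ * - ln _); rewrite -mulf_div divff ?mul1r //.
by rewrite mulf_neq0 // gt_eqF // arrival_prob_gt0.
Qed.
End Law.

(** * Optimization within one slot *)

(** Boolean, so that it can serve as a 0/1 weight in Gibbs' inequality. *)
Definition feasibleb (q : {set color}) (i : {set color}) (o : 2.-bseq color) : bool :=
  ((Red \in q) <= count_mem Red o <= (Red \in q) + (Red \in i))%N &&
  ((Blue \in q) <= count_mem Blue o <= (Blue \in q) + (Blue \in i))%N.

Lemma feasibleP q i o : reflect (feasible q i o) (feasibleb q i o).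
Proof.
by apply: (iffP andP) => [[hr hb] []|h] //; exact: (conj (h Red) (h Blue)).
Qed.

Section Bellman.
Variables (R : realType) (X Y : R).
Hypotheses (hX : 1 <= X <= 2) (hY : 1 <= Y <= 2).

(* Exponential of the relative value of backlog [q]; psi* never reaches RB,
   so that its value 2 only has to be an upper bound there, and small enough
   never to make leaving both packets in the Mix profitable. *)
Definition value (q : {set color}) : R :=
  if Red \in q then if Blue \in q then 2 else X
  else if Blue \in q then Y else 1.

(* The largest sum, over the feasible outputs of one size, of the value of the
   next backlog. *)
Definition best (q i : {set color}) : R :=
  match Red \in q, Blue \in q, Red \in i, Blue \in i with
  | false, false, false, false => 1
  | false, false, true, false => X
  | false, false, false, true => Y
  | false, false, true, true => X + Y
  | true, false, false, false => 1
  | true, false, true, false => X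
  | true, false, false, true => 2
  | true, false, true, true => Y + 2 * X
  | false, true, false, false => 1
  | false, true, true, false => 2
  | false, true, false, true => Y
  | false, true, true, true => X + 2 * Y
  | true, true, _, _ => 2 * value i
  end.

Lemma value_bounds q : 1 <= value q <= 2.
Proof. by rewrite /value; do 2![case: ifP => _]; move: hX hY; lra. Qed.

Lemma best_gt0 q i : 0 < best q i.
Proof.
have := value_bounds i; rewrite /best.
by case: (Red \in q); case: (Blue \in q); case: (Red \in i); case: (Blue \in i);
  move: hX hY; lra.
Qed.

(** In each case one size dominates because X and Y lie in [1, 2]. With empty backlog and arrivals
    RB, for instance, sizes 0 and 2 both give 2, while size 1 gives X + Y >= 2. *)
Lemma sum_feasible_value_le q i s :
  \sum_(o : 2.-bseq color | size o == s)
     (feasibleb q i o)%:R * value (next_queue q (i, o)) <= best q i.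
Proof.
rewrite sum_outputs !big_cons big_nil /best /feasibleb /value /next_queue !inE /=.
case: s => [|[|[|s]]] /=;
case: (Red \in q); case: (Blue \in q); case: (Red \in i); case: (Blue \in i) => /=;
rewrite ?mul0r ?mul1r ?addr0 ?add0r.
all: move: hX hY.
all: try lra.
Qed.

(** The equality case of Gibbs' inequality: in each reachable state the rule uses a single output
    size and weights each output proportionally to the value of the backlog it leaves. The second
    conclusion says that observing the size reveals nothing. *)
Lemma star_support p d r q i o :
  p * (X + Y) = Y -> d * (Y + 2 * X) = Y -> r * (X + 2 * Y) = X ->
  q != [set Red; Blue] -> 0 < star_rule p d r q i o ->
  [/\ best q i * star_rule p d r q i o = value (next_queue q (i, o)),
      \sum_(o' : 2.-bseq color | size o' == size o) star_rule p d r q i o' = 1 &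
      next_queue q (i, o) != [set Red; Blue]].
Proof.
move=> hp hd hr; rewrite sum_outputs !big_cons big_nil /star_rule !eq_colors.
rewrite /best /value /next_queue !inE /=.
case: (Red \in q); case: (Blue \in q) => //= _; case: (Red \in i); case: (Blue \in i) => /=;
case: o => [[|[] [|[] [|? ?]]] ho] //=.
all: rewrite /mix /send_shuffled /mix /send /=.
all: rewrite ?ltxx //.
all: move=> pos; split => //.
all: try lra.
Qed.

Lemma star_feasible (p d r : R) q i o : 0 < star_rule p d r q i o -> feasible q i o.
Proof.
move=> h; apply/feasibleP; move: h; rewrite /star_rule !eq_colors /feasibleb !inE.
case: (Red \in q); case: (Blue \in q) => //=; case: (Red \in i); case: (Blue \in i) => /=;
case: o => [[|[] [|[] [|? ?]]] ho] //=.
all: rewrite /mix /send_shuffled /mix /send /=.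
all: try lra.
Qed.

Lemma star_randomized (p d r : R) : 0 <= p <= 1 -> 0 <= d <= 1 -> 0 <= r <= 1 ->
  randomized (psi_star p d r).
Proof.
move=> hp hd hr h i; rewrite /psi_star sum_outputs !big_cons big_nil /star_rule !eq_colors !inE.
case: (Red \in _); case: (Blue \in _) => //=; case: (Red \in i); case: (Blue \in i) => /=.
all: split; rewrite /mix /send_shuffled /mix /send /=.
all: try lra.
all: move=> o; move: hp hd hr; do ?case: (_ == _) => /=; lra.
Qed.
End Bellman.

(** * Bellman inequality and upper bound on the entropy *)

Section Average.
Variables (R : realType) (lamR lamB X Y : R).
Hypotheses (hR : 0 < lamR < 1) (hB : 0 < lamB < 1).
Hypotheses (hX : 1 <= X <= 2) (hY : 1 <= Y <= 2).
(** The average reward per slot in nats, read off the Bellman equation at the empty backlog, whose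
    relative value is ln 1 = 0. *)
Let G := lamR * (1 - lamB) * ln X + lamB * (1 - lamR) * ln Y
         + lamR * lamB * ln (X + Y).
Hypothesis bellmanR : ln X + lamB * (1 - lamR) * ln Y + lamR * lamB * ln (X + Y) =
  lamB * (1 - lamR) * ln 2 + lamR * lamB * ln (Y + 2 * X).
Hypothesis bellmanB : ln Y + lamR * (1 - lamB) * ln X + lamR * lamB * ln (X + Y) =
  lamR * (1 - lamB) * ln 2 + lamR * lamB * ln (X + 2 * Y).

Local Notation value := (value X Y).
Local Notation best := (best X Y).
Local Notation law := (law lamR lamB).

Lemma bellman_eq q : q != [set Red; Blue] ->
  \sum_i arrival_prob lamR lamB i * ln (best q i) = G + ln (value q).
Proof.
rewrite eq_colors sum_colors /arrival_prob /best /value /G !inE /=.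
case: (Red \in q); case: (Blue \in q) => //= _; rewrite ?ln1.
all: move: bellmanR bellmanB; lra.
Qed.

(** A general strategy may reach backlog RB, where only an inequality holds: the two sides differ by
    lamR lamB (ln (X + Y) - ln 2) >= 0. *)
Lemma bellman_le q :
  \sum_i arrival_prob lamR lamB i * ln (best q i) <= G + ln (value q).
Proof.
have [->|/bellman_eq ->//] := eqVneq q [set Red; Blue].
have [x1 x2] := andP hX; have [y1 y2] := andP hY.
rewrite sum_colors /arrival_prob /best /value /G !inE /= mulr1.
have -> : ln (2 * X) = ln 2 + ln X by rewrite lnM ?posrE; lra.
have -> : ln (2 * Y) = ln 2 + ln Y by rewrite lnM ?posrE; lra.
have -> : ln (2 * 2) = ln 2 + ln 2 :> R by rewrite lnM ?posrE; lra.
have h : ln 2 <= ln (X + Y) by rewrite ler_ln ?posrE; lra.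
have : 0 <= lamR * lamB * (ln (X + Y) - ln 2).
  by rewrite mulr_ge0 ?subr_ge0 // mulr_ge0; move: hR hB; lra.
lra.
Qed.

Definition mean_value (psi : strategy R) n : R :=
  \sum_(w : n.-tuple slot) law psi w * ln (value (backlog w)).

Lemma ln_value_bounds q : 0 <= ln (value q) <= ln 2.
Proof.
have /andP[v1 v2] := value_bounds hX hY q.
by rewrite ln_ge0 // ler_ln ?posrE; lra.
Qed.

(** This bound, uniform in n, makes the boundary terms of the telescoped sum negligible after
    division by N. *)
Lemma mean_value_bounds psi n : randomized psi -> 0 <= mean_value psi n <= ln 2.
Proof.
move=> rpsi; have l0 w := @law_ge0 _ _ _ hR hB _ rpsi n w.
have v q := andP (ln_value_bounds q).
apply/andP; split.
  by apply: sumr_ge0 => w _; rewrite mulr_ge0 // (v _).1.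
have -> : ln 2 = \sum_(w : n.-tuple slot) law psi w * ln 2.
  by rewrite -mulr_suml sum_law // mul1r.
by apply: ler_sum => w _; rewrite ler_wpM2l // (v _).2.
Qed.

Lemma slot_entropy_add_mean_value psi m : randomized psi ->
  slot_entropy lamR lamB psi m * ln 2 + mean_value psi m.+1 =
  \sum_(h : m.-tuple slot) law psi h *
    \sum_i arrival_prob lamR lamB i *
      \sum_o psi h i o * (ln (value (next_queue (backlog h) (i, o))) -
        ln (psi h i o / \sum_(o' : 2.-bseq color | size o' == size o) psi h i o')).
Proof.
move=> rpsi; rewrite slot_entropyE // /mean_value sum_law_rcons // -big_split /=.
apply: eq_bigr => h _; rewrite -mulrDr; congr (_ * _).
rewrite -big_split /=; apply: eq_bigr => i _; rewrite -mulrDr; congr (_ * _).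
rewrite -big_split /=; apply: eq_bigr => o _.
by rewrite backlog_rcons -mulrDr addrC.
Qed.

Lemma sum_law_bellman psi m : randomized psi ->
  \sum_(h : m.-tuple slot) law psi h * (G + ln (value (backlog h))) =
  G + mean_value psi m.
Proof.
move=> rpsi; under eq_bigr do rewrite mulrDr.
by rewrite big_split /= -mulr_suml sum_law // mul1r.
Qed.

Lemma slot_entropy_le psi m : Psi1 lamR lamB psi ->
  slot_entropy lamR lamB psi m * ln 2 + mean_value psi m.+1 <= G + mean_value psi m.
Proof.
case=> rpsi delay; rewrite slot_entropy_add_mean_value // -sum_law_bellman //.
apply: ler_sum => h _; have := law_ge0 hR hB rpsi h.
rewrite le_eqVlt => /orP[/eqP <-|lawh]; first by rewrite !mul0r.
rewrite ler_pM2l //; apply: le_trans (bellman_le _).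
apply: ler_sum => i _; rewrite ler_pM2l ?arrival_prob_gt0 //.
(* The delay constraint speaks only of histories of positive probability; h extended by (i, o) is
   one. *)
have feas o : 0 < psi h i o -> feasibleb (backlog h) i o.
  move=> psio; apply/feasibleP.
  have lawr : 0 < law psi [tuple of rcons h (i, o)] by rewrite law_rcons_gt0 ?lawh.
  have := delay _ _ lawr ord_max.
  by rewrite (tnth_nth (i, o)) /= nth_rcons -cats1 take_size_cat ?size_tuple ?ltnn ?eqxx.
(* Extending the value by 0 to infeasible outputs lets [best] bound every group sum, and changes
   nothing where psi is positive. *)
pose w o := (feasibleb (backlog h) i o)%:R * value (next_queue (backlog h) (i, o)).
have vpos q : 0 < value q by have := value_bounds hX hY q; lra.
have [psi0 psi1] := rpsi h i.
rewrite (eq_bigr (fun o => psi h i o * (ln (w o) -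
    ln (psi h i o / \sum_(o' : 2.-bseq color | size o' == size o) psi h i o')))).
  apply: (@gibbs_grouped _ _ _ (fun o : 2.-bseq color => size o)) => //.
  - by move=> o; rewrite /w mulr_ge0 ?ler0n // ltW.
  - by move=> o /feas fo; rewrite /w fo mul1r.
  - exact: best_gt0.
  - by move=> s; apply: sum_feasible_value_le.
move=> o _; have := psi0 o; rewrite le_eqVlt => /orP[/eqP <-|/feas fo].
  by rewrite !mul0r.
by rewrite /w fo mul1r.
Qed.

(** * The star strategy attains the bound *)

Variables p d r : R.
Hypotheses (hp01 : 0 <= p <= 1) (hd01 : 0 <= d <= 1) (hr01 : 0 <= r <= 1).
Hypotheses (hp : p * (X + Y) = Y) (hd : d * (Y + 2 * X) = Y) (hr : r * (X + 2 * Y) = X).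
Local Notation star := (psi_star p d r).

Lemma star_backlog n (w : n.-tuple slot) :
  0 < law star w -> backlog w != [set Red; Blue].
Proof.
elim: n w => [|n IHn] w; first by rewrite tuple0 eq_colors !inE.
have rstar := star_randomized hp01 hd01 hr01.
case/tupleP: w => x t.
(* The law factors at the last slot, so the tuple is split there and not at its head. *)
have [h [y ->]] : exists (h : n.-tuple slot) y, [tuple of x :: t] = [tuple of rcons h y].
  by exists [tuple of belast x t], (last x t); apply: val_inj; rewrite /= -lastI.
rewrite law_rcons_gt0 // => /andP[/IHn hh sy].
by rewrite backlog_rcons; case: y sy => i o /= sy; case: (star_support hp hd hr hh sy).
Qed.

Lemma star_Psi1 : Psi1 lamR lamB star.
Proof.
have rstar := star_randomized hp01 hd01 hr01; split => // n w.
rewrite /law => wpos k; apply: (@star_feasible _ p d r).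
have [s0 _] := rstar (take k w) (tnth w k).1.
rewrite lt0r s0 andbT; apply: contraTneq wpos => e.
by rewrite (bigD1 k) //= {1}/psi_star e mulr0 mul0r ltxx.
Qed.

(** On the support of the rule, the log-value of the next backlog minus ln of the output probability
    is the constant ln [best], so Gibbs' bound is an equality; RB being unreachable, so is
    Bellman's. *)
Lemma slot_entropy_star m :
  slot_entropy lamR lamB star m * ln 2 + mean_value star m.+1 = G + mean_value star m.
Proof.
have [rstar _] := star_Psi1.
rewrite slot_entropy_add_mean_value // -sum_law_bellman //.
apply: eq_bigr => h _; have := law_ge0 hR hB rstar h.
rewrite le_eqVlt => /orP[/eqP <-|/star_backlog qh]; first by rewrite !mul0r.
congr (_ * _); rewrite -bellman_eq //.
apply: eq_bigr => i _; congr (_ * _); have [s0 s1] := rstar h i.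
rewrite -[RHS]mul1r -s1 mulr_suml; apply: eq_bigr => o _.
have := s0 o; rewrite le_eqVlt => /orP[/eqP <-|so]; first by rewrite !mul0r.
have [<- -> _] := star_support hp hd hr qh so.
by rewrite divr1 lnM ?posrE ?best_gt0 // addrK.
Qed.

(** * Telescoping and passage to the limit *)

Lemma sum_slot_entropy_le psi N : Psi1 lamR lamB psi ->
  (\sum_(m < N) slot_entropy lamR lamB psi m) * ln 2 + mean_value psi N <=
  N%:R * G + mean_value psi 0.
Proof.
move=> hpsi; elim: N => [|N IHN]; first by rewrite big_ord0 mul0r mul0r.
by rewrite big_ord_recr /= -natr1; have := slot_entropy_le N hpsi; lra.
Qed.

Lemma sum_slot_entropy_star N :
  (\sum_(m < N) slot_entropy lamR lamB star m) * ln 2 + mean_value star N =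
  N%:R * G + mean_value star 0.
Proof.
elim: N => [|N IHN]; first by rewrite big_ord0 mul0r mul0r.
by rewrite big_ord_recr /= -natr1; have := slot_entropy_star N; lra.
Qed.

Let rate := G / (ln 2 * (lamR + lamB)).
(** Boundary terms are at most ln 2 in nats, that is one bit, spread over N = n + 1 slots;
    [harmonic n] is 1 / (n + 1). *)
Let slack (n : nat) := (lamR + lamB)^-1 * harmonic n : R.

Lemma anonymity_seqS_le psi n : Psi1 lamR lamB psi ->
  anonymity_seq lamR lamB psi n.+1 <= rate + slack n.
Proof.
move=> hpsi; have c0 := ln2_gt0 R; have l0 : 0 < lamR + lamB by move: hR hB; lra.
rewrite /anonymity_seq; set S := \sum_(m < _) _.
have n0 : 0 < n.+1%:R :> R by rewrite ltr0n.
have -> : rate + slack n = (n.+1%:R * (lamR + lamB))^-1 * ((n.+1%:R * G + ln 2) / ln 2).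
  by rewrite /rate /slack /harmonic /=; field; rewrite nat1r !gt_eqF.
rewrite ler_pM2l ?invr_gt0 ?mulr_gt0 // ler_pdivlMr //.
have := sum_slot_entropy_le n.+1 hpsi; rewrite -/S.
by have := mean_value_bounds 0 hpsi.1; have := mean_value_bounds n.+1 hpsi.1; lra.
Qed.

Lemma anonymity_seqS_star_ge n : rate - slack n <= anonymity_seq lamR lamB star n.+1.
Proof.
have c0 := ln2_gt0 R; have l0 : 0 < lamR + lamB by move: hR hB; lra.
rewrite /anonymity_seq; set S := \sum_(m < _) _.
have n0 : 0 < n.+1%:R :> R by rewrite ltr0n.
have -> : rate - slack n = (n.+1%:R * (lamR + lamB))^-1 * ((n.+1%:R * G - ln 2) / ln 2).
  by rewrite /rate /slack /harmonic /=; field; rewrite nat1r !gt_eqF.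
rewrite ler_pM2l ?invr_gt0 ?mulr_gt0 // ler_pdivrMr //.
have := sum_slot_entropy_star n.+1; rewrite -/S; have [rstar _] := star_Psi1.
by have := mean_value_bounds 0 rstar; have := mean_value_bounds n.+1 rstar; lra.
Qed.

Lemma slack_cvg0 : (slack @ \oo --> (0 : R)%R)%classic.
Proof.
rewrite -(mulr0 (lamR + lamB)^-1); apply: cvgMl_tmp; exact: cvg_harmonic.
Qed.

(** The upper estimate holds on all of [Psi1], the lower one for the star strategy, and both tend to
    [rate]. Shifting the sequences by one discards N = 0 without changing limits. *)
Lemma star_optimal : optimal lamR lamB star.
Proof.
have up : ((fun n => rate + slack n)%R @ \oo --> rate)%classic.
  by rewrite -[X in (_ --> X)%classic]addr0; apply: cvgD; [exact: cvg_cst|exact: slack_cvg0].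
have lo : ((fun n => rate - slack n)%R @ \oo --> rate)%classic.
  by rewrite -[X in (_ --> X)%classic]subr0; apply: cvgB; [exact: cvg_cst|exact: slack_cvg0].
have cstar : (anonymity_seq lamR lamB star @ \oo --> rate)%classic.
  rewrite -cvg_shiftS; apply: squeeze_cvgr lo up; apply: nearW => n /=.
  by rewrite anonymity_seqS_star_ge anonymity_seqS_le //; exact: star_Psi1.
split; [exact: star_Psi1 | by apply/cvg_ex; exists rate |].
move=> phi hphi cphi; rewrite {2}/anonymity (cvg_lim _ cstar) //.
have cphi' : ((fun n => anonymity_seq lamR lamB phi n.+1) @ \oo -->
    anonymity lamR lamB phi)%classic by rewrite (cvg_shiftS (anonymity_seq lamR lamB phi)).
by apply: ler_cvg_to cphi' up _; apply: nearW => n; exact: anonymity_seqS_le.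
Qed.

End Average.

Theorem proposition1 (R : realType) (lamR lamB : R)
    (hR : 0 < lamR < 1) (hB : 0 < lamB < 1) :
  exists p d r : R,
    [/\ 0 <= p <= 1, 0 <= d <= 1, 0 <= r <= 1,
        optimal lamR lamB (psi_star p d r) &
        forall (n : nat) (w : n.-tuple slot),
          0 < law lamR lamB (psi_star p d r) w ->
          backlog w <> [set Red; Blue]].
Proof.
have [X [Y [hX hY eR eB]]] := bellman_solution hR hB.
have frac (x y : R) : 0 < x -> 0 < y -> 0 <= y / (x + y) <= 1.
  by move=> x0 y0; rewrite ler_pdivrMr ?ler_pdivlMr ?mul0r; lra.
(* Gibbs weights: sending R, RR or BB leaves a backlog worth Y, Y or X, out of the corresponding
   total [best]. *)
have hp : Y / (X + Y) * (X + Y) = Y by rewrite divfK // gt_eqF //; lra.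
have hd : Y / (Y + 2 * X) * (Y + 2 * X) = Y by rewrite divfK // gt_eqF //; lra.
have hr : X / (X + 2 * Y) * (X + 2 * Y) = X by rewrite divfK // gt_eqF //; lra.
have hp01 : 0 <= Y / (X + Y) <= 1 by apply: frac; lra.
have hd01 : 0 <= Y / (Y + 2 * X) <= 1 by rewrite addrC; apply: frac; lra.
have hr01 : 0 <= X / (X + 2 * Y) <= 1 by rewrite addrC; apply: frac; lra.
exists (Y / (X + Y)), (Y / (Y + 2 * X)), (X / (X + 2 * Y)); split => //.
  exact: (star_optimal hR hB hX hY eR eB hp01 hd01 hr01 hp hd hr).
by move=> n w lw; apply/eqP; exact: (star_backlog hR hB hp01 hd01 hr01 hp hd hr lw).
Qed.
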